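(* Let $R$ be an infinite integral domain whose additive group $R^+$ is a finitely generated abelian group, let $R^*$ denote the group of invertible elements of $R$, and let $n\geq 2$ be an integer. If $n\leq |R^*|$ (where $R^*$ may be infinite), then the group $\mathrm{UT}_n(R)$ of upper unitriangular $n\times n$ matrices over $R$ does not possess the $R_\infty$-property, i.e. there exists a group automorphism $\varphi$ of $\mathrm{UT}_n(R)$ with $R(\varphi)<\infty$.
   Context: An integral domain is an associative commutative ring with unit and without zero divisors. $\mathrm{UT}_n(R)$ is the group (under matrix multiplication) of $n\times n$ matrices over $R$ with $1$ on the diagonal, $0$ below the diagonal and arbitrary entries above the diagonal. For a group $G$ and an automorphism $\varphi$ of $G$, elements $x,y\in G$ are $\varphi$-conjugated if there is $z\in G$ with $x=zy\varphi(z)^{-1}$; this is an equivalence relation, and the number $R(\varphi)\in\mathbb{N}\cup\{\infty\}$ of its equivalence classes is the Reidemeister number of $\varphi$ (all infinite cardinalities are recorded as $\infty$). $G$ possesses the $R_\infty$-property if $R(\varphi)=\infty$ for every automorphism $\varphi$ of $G$. *)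

(* Defs.v *)
From HB Require Import structures.
From mathcomp Require Import all_boot all_order all_algebra.
From mathcomp Require Import finmap.
From mathcomp Require Import boolp classical_sets functions cardinality.

Set Implicit Arguments.
Unset Strict Implicit.
Unset Printing Implicit Defensive.

Import GRing.Theory.
Local Open Scope ring_scope.

Section UpperUnitriangularGroup.
Variables (R : comUnitRingType) (n : nat).
Implicit Types A B : 'M[R]_n.

Definition is_unitri_mx A :=
  [forall i : 'I_n, forall j : 'I_n, (j <= i)%N ==> (A i j == (i == j)%:R)].

Lemma is_unitri_mxP A :
  reflect (forall i j : 'I_n, (j <= i)%N -> A i j = (i == j)%:R)
          (is_unitri_mx A).
Proof.
apply: (iffP forallP) => [uA i j le_ji | uA i].
  by have /forallP/(_ j)/implyP/(_ le_ji)/eqP := uA i.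
by apply/forallP => j; apply/implyP => /uA/eqP.
Qed.

Lemma unitri_mx1 : is_unitri_mx 1%:M.
Proof. by apply/is_unitri_mxP => i j _; rewrite mxE. Qed.

Lemma unitri_mxM A B :
  is_unitri_mx A -> is_unitri_mx B -> is_unitri_mx (A *m B).
Proof.
move=> /is_unitri_mxP uA /is_unitri_mxP uB; apply/is_unitri_mxP => i j le_ji.
rewrite mxE (bigD1 i) //= uA // eqxx mul1r uB // big1 ?addr0 // => k ne_ki.
have [le_ki|lt_ik] := leqP k i; first by rewrite uA // eq_sym (negPf ne_ki) mul0r.
have lt_jk := leq_ltn_trans le_ji lt_ik.
by rewrite uB ?(ltnW lt_jk) // (_ : (k == j) = false) ?mulr0 // -val_eqE gtn_eqF.
Qed.

Lemma unitri_mx_unit A : is_unitri_mx A -> A \in unitmx.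
Proof.
move=> /is_unitri_mxP uA; rewrite unitmxE -det_tr det_trig; last first.
  by apply/is_trig_mxP => i j lt_ij; rewrite mxE uA ?(ltnW lt_ij) // -val_eqE gtn_eqF.
by rewrite big1 ?unitr1 // => i _; rewrite mxE uA // eqxx.
Qed.

Lemma unitri_mxV A : is_unitri_mx A -> is_unitri_mx (invmx A).
Proof.
move=> utA; have AV := mulmxV (unitri_mx_unit utA).
move/is_unitri_mxP: utA => uA; apply/is_unitri_mxP => i j.
have [m] := ubnP (n - i); elim: m i => // m IHm i lt_m le_ji.
have /matrixP/(_ i j) := AV; rewrite !mxE (bigD1 i) //= uA // eqxx mul1r.
rewrite big1 ?addr0 // => k ne_ki.
have [le_ki|lt_ik] := leqP k i; first by rewrite uA // eq_sym (negPf ne_ki) mul0r.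
have lt_jk := leq_ltn_trans le_ji lt_ik.
rewrite IHm ?(ltnW lt_jk) //.
  by rewrite (_ : (k == j) = false) ?mulr0 // -val_eqE gtn_eqF.
by rewrite -ltnS (leq_trans _ lt_m) // ltnS ltn_sub2l.
Qed.

Record UT := MkUT { UT_mx :> 'M[R]_n; UT_mxP : is_unitri_mx UT_mx }.

HB.instance Definition _ := [isSub for UT_mx].
HB.instance Definition _ := [Choice of UT by <:].

Definition UT_one := MkUT unitri_mx1.
Definition UT_mul (x y : UT) := MkUT (unitri_mxM (UT_mxP x) (UT_mxP y)).
Definition UT_inv (x : UT) := MkUT (unitri_mxV (UT_mxP x)).

Lemma UT_mulA : associative UT_mul.
Proof. by move=> x y z; apply: val_inj; rewrite /= mulmxA. Qed.

Lemma UT_mul1 : left_id UT_one UT_mul.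
Proof. by move=> x; apply: val_inj; rewrite /= mul1mx. Qed.

Lemma UT_mulr1 : right_id UT_one UT_mul.
Proof. by move=> x; apply: val_inj; rewrite /= mulmx1. Qed.

Lemma UT_mulV : left_inverse UT_one UT_inv UT_mul.
Proof.
by move=> x; apply: val_inj; rewrite /= mulVmx // unitri_mx_unit ?UT_mxP.
Qed.

Lemma UT_mulrV : right_inverse UT_one UT_inv UT_mul.
Proof.
by move=> x; apply: val_inj; rewrite /= mulmxV // unitri_mx_unit ?UT_mxP.
Qed.

HB.instance Definition _ :=
  isGroup.Build UT UT_mulA UT_mul1 UT_mulr1 UT_mulV UT_mulrV.

End UpperUnitriangularGroup.

Section Reidemeister.
Local Open Scope classical_set_scope.
Local Open Scope group_scope.
Variable G : groupType.

Definition twisted_conj (phi : G -> G) (x y : G) : Prop :=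
  exists z, x = z * y * (phi z)^-1.

Definition twisted_classes (phi : G -> G) : set (set G) :=
  range (fun y => [set x | twisted_conj phi x y]).

(* Values in N with infinity adjoined: None stands for infinity. *)
Definition reidemeister_number (phi : G -> G) : option nat :=
  if `[< finite_set (twisted_classes phi) >]
  then Some #|` fset_set (twisted_classes phi)| else None.

(* Automorphisms are the bijective multiplicative self-maps. *)
Definition R_infty_property : Prop :=
  forall phi : {multiplicative G -> G},
    bijective phi -> reidemeister_number phi = None.

End Reidemeister.
Arguments R_infty_property : clear implicits.

Definition fg_zmod (V : zmodType) : Prop :=
  exists (m : nat) (s : m.-tuple V), forall v, inIntSpan s v.

(* Main.v *)
Require Import Defs.
From HB Require Import structures.
From mathcomp Require Import all_boot all_order all_algebra.
From mathcomp Require Import boolp classical_sets functions cardinality.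
From mathcomp Require Import ring.

(** Fix pairwise distinct units [d_1, ..., d_n] of [R] and let [phi] be
    conjugation by [diag(d_1, ..., d_n)]: it multiplies the [(i, j)] entry by
    [d_i / d_j], which differs from [1] for [i < j].

    Every nonzero [a] in [R] has finite index [aR] in [R]
    ([finite_residues]): multiplication by [a] is given on a finite family of
    generators of the additive group by an integer matrix, whose
    characteristic polynomial therefore vanishes at [a]
    ([fg_zmod_int_root]); dividing it by a power of [X] leaves a relation
    with nonzero constant term, that is, a nonzero integer [N] in [aR]
    ([int_multiple_of_root]), and [R / NR] is finite because the additive
    group is finitely generated. With [a] the product of all the
    [1 - d_i / d_j], one finite set [S] represents the residues modulo each
    of these factors.

    Finally every [x] is [phi]-conjugate to a matrix [y] with entries in [S]
    above the diagonal ([diag_conj_residues]). On the first superdiagonal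
    where [y] is still free, the equation [z y = x phi(z)] reads
    [y_ij + (1 - d_i / d_j) z_ij = c_ij] with [c_ij] determined by the
    superdiagonals already treated, so that [y_ij] can be taken to be the
    residue of [c_ij] in [S]. There are finitely many such [y], hence
    finitely many classes. *)

Local Open Scope classical_set_scope.
Local Open Scope card_scope.
Local Open Scope ring_scope.

Set Implicit Arguments.
Unset Strict Implicit.
Unset Printing Implicit Defensive.
Import Order.TTheory GRing.Theory Num.Theory.

(** * Finiteness of residue rings *)

(** The determinant trick: [char_poly A] at [a] is the determinant of
    [a - A], which the adjugate turns into a scalar annihilating every
    generator, hence also their combination [1]. *)
Lemma fg_zmod_int_root (R : comNzRingType) (a : R) : fg_zmod R ->
  exists2 p : {poly int}, p != 0 & (map_poly intr p).[a] = 0.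
Proof.
move=> [m [s gen_s]].
have /choice[c cE] : forall i : 'I_m, exists c : int ^ m,
    a * s`_i = \sum_(j < m) s`_j *~ c j by move=> i; exact: gen_s.
pose A : 'M[int]_m := \matrix_(i, j) c i j.
exists (char_poly A); first exact/monic_neq0/char_poly_monic.
rewrite map_char_poly; set B : 'M[R]_m := map_mx _ A.
have -> : (char_poly B).[a] = \det (a%:M - B).
  rewrite -horner_evalE /char_poly -det_map_mx; congr (\det _).
  apply/matrixP => i j; by rewrite !mxE /= horner_evalE !(hornerE, hornerMn).
pose e : 'cV[R]_m := \col_i s`_i.
have Be : (a%:M - B) *m e = 0.
  apply/matrixP => i j; rewrite mulmxBl mul_scalar_mx !mxE cE -sumrB.
  rewrite big1 // => k _.
  by rewrite !mxE mulrzl subrr.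
have det_s (i : 'I_m) : \det (a%:M - B) * s`_i = 0.
  have /matrixP/(_ i 0) : \det (a%:M - B) *: e = 0.
    by rewrite -mul_scalar_mx -mul_adj_mx -mulmxA Be mulmx0.
  by rewrite !mxE.
have [b bE] := gen_s 1.
rewrite -[LHS]mulr1 bE mulr_sumr big1 // => i _.
by rewrite mulrzAr det_s mul0rz.
Qed.

(** Write [p = q X + c]: if [c] is nonzero then [c = - q(a) a] is the integer
    sought; otherwise [a] cancels, and is a root of [q]. *)
Lemma int_multiple_of_root (R : idomainType) (a : R) (p : {poly int}) :
  a != 0 -> p != 0 -> (map_poly intr p).[a] = 0 ->
  exists2 N : int, N != 0 & exists b, N%:~R = a * b.
Proof.
move=> a0; elim/poly_ind: p => [|p c IHp]; first by rewrite eqxx.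
rewrite rmorphD rmorphM /= map_polyX map_polyC /= !hornerE => pc0 pa0.
have [c0|c_neq0] := eqVneq c 0; last first.
  exists c => //; exists (- (map_poly intr p).[a]).
  by rewrite mulrN mulrC; apply/eqP; rewrite -addr_eq0 addrC pa0.
apply: IHp; first by apply: contraNneq pc0 => ->; rewrite c0 mul0r addr0.
by move/eqP: pa0; rewrite c0 addr0 mulf_eq0 (negPf a0) orbF => /eqP.
Qed.

(** A nonzero integer [N = a b] reduces the question to residues modulo [N],
    where the coordinates on the generators can be reduced one by one. *)
Lemma finite_residues (R : idomainType) (a : R) : fg_zmod R -> a != 0 ->
  exists S : seq R, forall r, exists2 s, s \in S & exists t, r = s + a * t.
Proof.
move=> fgR a0; have [p p0 pa0] := fg_zmod_int_root a fgR.
have [N N0 [b NE]] := int_multiple_of_root a0 p0 pa0.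
have [m [s gen_s]] := fgR.
exists [seq \sum_(i < m) s`_i *~ (k i : nat)%:Z
         | k : {ffun 'I_m -> 'I_(`|N|%N.-1.+1)}] => r.
have [c rE] := gen_s r.
pose k := [ffun i : 'I_m => inord `|(c i %% N)%Z|%N : 'I_(`|N|%N.-1.+1)].
have kE i : (k i : nat)%:Z = (c i %% N)%Z.
  rewrite ffunE inordK; first by rewrite gez0_abs ?modz_ge0.
  rewrite prednK ?absz_gt0 // -ltz_nat gez0_abs ?modz_ge0 //.
  by rewrite abszE ltz_mod.
exists (\sum_(i < m) s`_i *~ (k i : nat)%:Z).
  by apply/fintype.imageP; exists k.
exists (b * \sum_(i < m) s`_i *~ (c i %/ N)%Z).
rewrite mulrA -NE mulr_sumr -big_split rE; apply: eq_bigr => i _ /=.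
by rewrite kE {1}(divz_eq (c i) N) mulrzDr addrC mulrzl -mulrzA.
Qed.

(** * Twisted conjugacy classes *)

Section TwistedConj.
Local Open Scope group_scope.
Variables (G : groupType) (phi : {multiplicative G -> G}).

Lemma twisted_conjE x y :
  twisted_conj phi x y <-> exists z, z * y = x * phi z.
Proof.
split=> -[z zE]; exists z; first by rewrite zE mulgVK.
by rewrite zE mulgK.
Qed.

(** Between groups, [gmulfM] alone forces the unit and inverses to be preserved,
    whereas [gmulfV] asks for a morphism of unital magmas. *)
Lemma mult_gmulfV : {morph phi : x / x^-1}.
Proof.
have phi1 : phi 1 = 1 by rewrite -[LHS](mulKg (phi 1)) -gmulfM mulg1 mulVg.
by move=> x; rewrite -[LHS](mulgK (phi x)) -gmulfM mulVg phi1 mul1g.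
Qed.

Lemma twisted_conj_sym x y : twisted_conj phi x y -> twisted_conj phi y x.
Proof.
move=> [z ->]; exists z^-1.
by rewrite mult_gmulfV invgK !mulgA mulVg mul1g mulgVK.
Qed.

Lemma twisted_conj_trans x y w :
  twisted_conj phi x y -> twisted_conj phi y w -> twisted_conj phi x w.
Proof.
move=> [z ->] [t ->]; exists (z * t).
by rewrite gmulfM invgM !mulgA.
Qed.

Lemma finite_reidemeister (I : finType) (rep : I -> G) :
  (forall x, exists k, twisted_conj phi x (rep k)) ->
  reidemeister_number phi <> None.
Proof.
move=> repP; rewrite /reidemeister_number asboolT //.
pose cls y := [set x | twisted_conj phi x y].
apply: (@sub_finite_set _ _ ((cls \o rep) @` [set: I])); last first.
  exact/finite_image/finite_finset.
move=> _ [y _ <-]; have [k yk] := repP y; exists k => //.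
apply/seteqP; split=> x /= xy; apply: (twisted_conj_trans xy) => //.
exact: twisted_conj_sym.
Qed.

End TwistedConj.

(** * Diagonal automorphisms of the unitriangular group *)

Section DiagConj.
Variables (R : comUnitRingType) (n : nat).
Implicit Types (x y z : UT R n) (f : 'I_n -> 'I_n -> R).

Fact unitri_fun_subproof f : is_unitri_mx
  (\matrix_(i < n, j < n) if (i < j)%N then f i j else (i == j)%:R).
Proof. by apply/is_unitri_mxP => i j le_ji; rewrite mxE ltnNge le_ji. Qed.

Definition unitri_fun f : UT R n := MkUT (unitri_fun_subproof f).

Lemma unitri_funE f i j :
  unitri_fun f i j = if (i < j)%N then f i j else (i == j)%:R.
Proof. by rewrite mxE. Qed.

Lemma UT_lowE x (i j : 'I_n) : (j <= i)%N -> x i j = (i == j)%:R.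
Proof. by move: i j; apply/is_unitri_mxP/UT_mxP. Qed.

Lemma UT_eqP x y : (forall i j, x i j = y i j) -> x = y.
Proof. by move=> xy; apply/val_inj/matrixP. Qed.

Lemma UT_mulE x y i j : (x * y)%g i j = \sum_k x i k * y k j.
Proof. by rewrite mxE. Qed.

(** To first order the product of unitriangular matrices is additive: changing
    the factors from the [m]-th superdiagonal on changes the product, on that
    superdiagonal, by the sum of the two changes. *)
Lemma UT_mul_perturb m x x' y y' (i j : 'I_n) :
  (forall k l : 'I_n, (l < k + m)%N -> x' k l = x k l) ->
  (forall k l : 'I_n, (l < k + m)%N -> y' k l = y k l) ->
  (i < j)%N -> (j <= i + m)%N ->
  (x' * y')%g i j - (x * y)%g i j = (x' i j - x i j) + (y' i j - y i j).
Proof.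
move=> eqx eqy lt_ij le_jm; have neq_ji : j != i by rewrite -val_eqE gtn_eqF.
rewrite !UT_mulE -sumrB (bigD1 i) //= (bigD1 j) //= big1 ?addr0; last first.
  move=> k /andP[neq_ki neq_kj].
  have [le_ki|lt_ik] := leqP k i.
    by rewrite !(UT_lowE _ le_ki) eq_sym (negPf neq_ki) !mul0r subrr.
  have [le_jk|lt_kj] := leqP j k.
    by rewrite !(UT_lowE _ le_jk) (negPf neq_kj) !mulr0 subrr.
  rewrite eqx ?eqy ?subrr //.
    by apply: leq_ltn_trans le_jm _; rewrite ltn_add2r.
  exact: leq_trans lt_kj le_jm.
by rewrite !(UT_lowE _ (leqnn _)) !eqxx !mul1r !mulr1 addrC.
Qed.

Variable d : 'I_n -> R.
Hypothesis d_unit : forall i, d i \is a GRing.unit.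

(** Conjugation by the diagonal matrix with entries [d]; going through
    [unitri_fun] makes the value unitriangular by construction, and
    [diag_conjE] gives all its entries when the [d i] are units. *)
Definition diag_conj x : UT R n := unitri_fun (fun i j => d i * x i j / d j).

Lemma diag_conjE x i j : diag_conj x i j = d i * x i j / d j.
Proof.
rewrite unitri_funE; case: ltnP => // le_ji; rewrite UT_lowE //.
by case: eqP => [->|_]; rewrite ?mulr1 ?divrr // mulr0 mul0r.
Qed.

Lemma diag_conjM : {morph diag_conj : x y / (x * y)%g}.
Proof.
move=> x y; apply: UT_eqP => i j.
rewrite diag_conjE !UT_mulE mulr_sumr mulr_suml; apply: eq_bigr => k _.
by rewrite !diag_conjE !mulrA mulrVK.
Qed.

(** Induction on the number [m] of superdiagonals on which
    [z y = x (diag_conj z)] already holds: by [UT_mul_perturb] the entries of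
    [y] and [z] on the next one enter that part of the equation linearly,
    through [y_ij + (1 - d_i / d_j) z_ij], and affect none of the earlier
    ones, so that division with remainder in [S] solves it. *)
Lemma diag_conj_residues (S : seq R) x :
  (forall i j : 'I_n, (i < j)%N -> forall r,
     exists2 s, s \in S & exists t, r = s + (1 - d i / d j) * t) ->
  exists y z, (forall i j : 'I_n, (i < j)%N -> y i j \in S) /\
              (z * y = x * diag_conj z)%g.
Proof.
move=> SP.
pose solved m y z := forall i j : 'I_n, (j < i + m)%N ->
  ((i < j)%N -> y i j \in S) /\ (z * y)%g i j = (x * diag_conj z)%g i j.
suff /(_ n)[y [z yz]] : forall m, exists y z, solved m y z.
  have {}yz i j := yz i j (ltn_addl _ (ltn_ord j)).
  exists y, z; split=> [i j|]; first exact: (yz i j).1.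
  by apply: UT_eqP => i j; have [] := yz i j.
elim=> [|m [y [z yz]]].
  exists 1%g, 1%g => i j; rewrite addn0 => lt_ji; split.
    by rewrite ltnNge (ltnW lt_ji).
  by rewrite !UT_lowE // ltnW.
have /choice[st stP] : forall ijr : 'I_n * 'I_n * R, exists st : R * R,
    (ijr.1.1 < ijr.1.2)%N -> st.1 \in S /\
    ijr.2 = st.1 + (1 - d ijr.1.1 / d ijr.1.2) * st.2.
  move=> [[i j] r] /=; case: (ltnP i j) => [lt_ij|_]; last by exists 0.
  by have [s sS [t rE]] := SP i j lt_ij r; exists (s, t).
(* the value that y i j + (1 - d i / d j) * z i j must take for the equation to
   hold at (i, j): its present value, corrected by the present defect *)
pose c i j := (x * diag_conj z)%g i j - (z * y)%g i j
              + (y i j + (1 - d i / d j) * z i j).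
pose y' := unitri_fun (fun i j =>
  if (j == i + m :> nat)%N then (st (i, j, c i j)).1 else y i j).
pose z' := unitri_fun (fun i j =>
  if (j == i + m :> nat)%N then (st (i, j, c i j)).2 else z i j).
have y'E (i j : 'I_n) : (j < i + m)%N -> y' i j = y i j.
  move=> lt_jm; rewrite unitri_funE ltn_eqF //.
  by case: ltnP => // le_ji; rewrite UT_lowE.
have z'E (i j : 'I_n) : (j < i + m)%N -> z' i j = z i j.
  move=> lt_jm; rewrite unitri_funE ltn_eqF //.
  by case: ltnP => // le_ji; rewrite UT_lowE.
have dz'E (i j : 'I_n) :
    (j < i + m)%N -> diag_conj z' i j = diag_conj z i j.
  by move=> lt_jm; rewrite !diag_conjE z'E.
exists y', z' => i j; rewrite addnS ltnS => le_jm.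
have [le_ji|lt_ij] := leqP j i; first by rewrite !UT_lowE.
have zy := UT_mul_perturb z'E y'E lt_ij le_jm.
have xdz := UT_mul_perturb (fun k l _ => erefl (x k l)) dz'E lt_ij le_jm.
move: (le_jm); rewrite leq_eqVlt => /orP[/eqP jE|lt_jm]; last first.
  have [yS yzE] := yz i j lt_jm; rewrite y'E //; split=> [_|]; first exact: yS.
  move: zy xdz; rewrite y'E // z'E // dz'E // !subrr addr0.
  by move=> /subr0_eq -> /subr0_eq ->; exact: yzE.
have [sS cE] := stP (i, j, c i j) lt_ij.
have y'ij : y' i j = (st (i, j, c i j)).1 by rewrite unitri_funE lt_ij jE eqxx.
have z'ij : z' i j = (st (i, j, c i j)).2 by rewrite unitri_funE lt_ij jE eqxx.
split=> [_|]; first by rewrite y'ij.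
move: cE; rewrite /= -y'ij -z'ij /c.
move: zy xdz; rewrite !diag_conjE.
move=> /(canRL (subrK _)) -> /(canRL (subrK _)) ->.
rewrite subrr add0r => /(canRL (addrK _))/(canRL (subrK _)) ->.
ring.
Qed.

End DiagConj.

Lemma diag_conj_bij (R : comUnitRingType) n (d : 'I_n -> R) :
  (forall i, d i \is a GRing.unit) -> bijective (diag_conj d).
Proof.
move=> d_unit; have dV_unit i : (d i)^-1 \is a GRing.unit by rewrite unitrV.
exists (diag_conj (fun i => (d i)^-1)) => x; apply: UT_eqP => i j.
  by rewrite !diag_conjE // invrK -mulrA mulrVK // mulKr.
by rewrite !diag_conjE // invrK -mulrA mulrK // mulVKr.
Qed.

Theorem proposition8 (R : idomainType) (n : nat)
  (R_infinite : infinite_set [set: R])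
  (R_fg : fg_zmod R)
  (n_ge2 : (2 <= n)%N)
  (n_le_units : `I_n #<= [set x : R | x \is a GRing.unit]) :
  ~ R_infty_property (UT R n) /\
  exists phi : {multiplicative UT R n -> UT R n},
    bijective phi /\ reidemeister_number phi <> None.
Proof.
suff phiP : exists phi : {multiplicative UT R n -> UT R n},
    bijective phi /\ reidemeister_number phi <> None.
  by split=> // Rinf; have [phi [/Rinf]] := phiP.
have [d d_unit d_inj] : exists2 d : 'I_n -> R,
    forall i, d i \is a GRing.unit & injective d.
  have /card_leP[f] := n_le_units.
  pose u (i : 'I_n) := f (SigSub (mem_set (ltn_ord i : `I_n i))).
  exists (fun i => val (u i)) => [i|i j /val_inj].
    exact: (set_mem (valP (u i))).
  by move=> eq_u; have [/ord_inj] := injT eq_u.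
pose M := isMultiplicative.Build _ _ _ (diag_conjM d_unit).
pose phi : {multiplicative UT R n -> UT R n} := HB.pack (diag_conj d) M.
exists phi; split; first exact: diag_conj_bij.
(* residues modulo a common multiple serve for every 1 - d i / d j at once *)
pose a := \prod_(ij : 'I_n * 'I_n | ij.1 != ij.2) (1 - d ij.1 / d ij.2).
have a0 : a != 0.
  apply/prodf_neq0 => -[i j] /= neq_ij.
  apply: contraNneq neq_ij => /subr0_eq ud.
  by apply/eqP/d_inj; rewrite -[RHS]mul1r ud mulrVK.
have [S SP] := finite_residues R_fg a0.
pose rep (k : {ffun 'I_n * 'I_n -> 'I_(size S).+1}) :=
  unitri_fun (fun i j => S`_(k (i, j))).
apply: (@finite_reidemeister _ phi _ rep) => x.
have [|y [z [yS zy]]] := @diag_conj_residues R n d d_unit S x.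
  move=> i j lt_ij r; have [s sS [t ->]] := SP r; exists s => //.
  rewrite /a (bigD1 (i, j)) /=; last by rewrite -val_eqE ltn_eqF.
  by rewrite -mulrA; eexists.
(* entries outside the strict upper triangle, where index may overflow to
   size S, are ignored by unitri_fun *)
exists [ffun ij => inord (index (y ij.1 ij.2) S)].
apply/twisted_conjE; exists z; rewrite -[RHS]zy; congr (_ * _)%g.
apply: UT_eqP => i j; rewrite unitri_funE ffunE /=.
case: ltnP => [lt_ij|/(UT_lowE y) //].
rewrite inordK ?ltnS ?index_size //.
by rewrite nth_index // yS.
Qed.
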